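(* Let $M,d\ge 1$, let $\boldsymbol{x}_1,\dots,\boldsymbol{x}_M\in\mathbb{R}^d$, let $w>0$, and let $f(\boldsymbol{z})=\sum_{m=1}^{M}\min(\|\boldsymbol{x}_m-\boldsymbol{z}\|^2,w^2)$ for $\boldsymbol{z}\in\mathbb{R}^d$. For every $n\in\{1,\dots,M\}$, the modified Epanechnikov Mean Shift iteration started at $\boldsymbol{x}_n$ (described in the context) terminates after a finite number of iterations, whatever choices are made in its sampling steps, and the point it returns is a local minimum of $f$.
   Context: For $\boldsymbol{z}\in\mathbb{R}^d$ let $\mathcal{I}(\boldsymbol{z})=\{i\in\{1,\dots,M\}:\|\boldsymbol{x}_i-\boldsymbol{z}\|^2<w^2\}$ and $\mathcal{J}(\boldsymbol{z})=\{j\in\{1,\dots,M\}:\|\boldsymbol{x}_j-\boldsymbol{z}\|^2=w^2\}$, where $\|\cdot\|$ is the Euclidean norm. Modified Epanechnikov Mean Shift iteration, with input $\boldsymbol{x}_1,\dots,\boldsymbol{x}_M$, $w$ and $n\in\{1,\dots,M\}$: set $\boldsymbol{z}^{(0)}=\boldsymbol{x}_n$. For $t=1,2,\dots$ do the following. (1) Set $\boldsymbol{z}^{(t)}=\frac{1}{|\mathcal{I}(\boldsymbol{z}^{(t-1)})|}\sum_{i\in\mathcal{I}(\boldsymbol{z}^{(t-1)})}\boldsymbol{x}_i$. (2) If $\boldsymbol{z}^{(t)}=\boldsymbol{z}^{(t-1)}$ and $\mathcal{J}(\boldsymbol{z}^{(t)})=\emptyset$, stop and return $\boldsymbol{z}^{(t)}$.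 (3) If $\boldsymbol{z}^{(t)}=\boldsymbol{z}^{(t-1)}$ and $\mathcal{J}(\boldsymbol{z}^{(t)})\neq\emptyset$, sample some $j\in\mathcal{J}(\boldsymbol{z}^{(t)})$ and redefine $\boldsymbol{z}^{(t)}=\frac{1}{|\mathcal{I}(\boldsymbol{z}^{(t-1)})|+1}\bigl(\boldsymbol{x}_j+\sum_{i\in\mathcal{I}(\boldsymbol{z}^{(t-1)})}\boldsymbol{x}_i\bigr)$. If the procedure has not stopped, continue with the next $t$. Each value of $t$ counts as one iteration. All computations are exact. *)

(* Defs.v *)
From mathcomp Require Import all_boot all_order all_algebra.
From mathcomp Require Import reals topology normedtype.
Set Implicit Arguments.
Unset Strict Implicit.
Unset Printing Implicit Defensive.

Import Order.TTheory GRing.Theory Num.Theory.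
Import numFieldNormedType.Exports.

Local Open Scope ring_scope.

(* The library norm `|v| on 'rV[R]_d is the sup norm, hence this definition. *)
Definition enorm (R : realType) (d : nat) (v : 'rV[R]_d) : R :=
  Num.sqrt (\sum_(k < d) v 0 k ^+ 2).

Definition local_minimum (R : realType) (T : topologicalType) (f : T -> R)
    (z : T) : Prop :=
  \forall y \near z, f z <= f y.

Section MeanShift.
Variables (R : realType) (d M : nat) (x : 'I_M -> 'rV[R]_d) (w : R).
Implicit Types (z : 'rV[R]_d) (A : {set 'I_M}).

Definition ms_objective z : R :=
  \sum_(m < M) Num.min (enorm (x m - z) ^+ 2) (w ^+ 2).

Definition ms_inner z : {set 'I_M} :=
  [set i | enorm (x i - z) ^+ 2 < w ^+ 2].

Definition ms_boundary z : {set 'I_M} :=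
  [set j | enorm (x j - z) ^+ 2 == w ^+ 2].

Definition centroid A : 'rV[R]_d := #|A|%:R^-1 *: \sum_(i in A) x i.

(* [Undefined] records an average over an empty index set; it is absorbing, so
   a run that reaches [Returned] has never averaged over an empty set. *)
Variant ms_state : Type :=
  | Running of 'rV[R]_d
  | Returned of 'rV[R]_d
  | Undefined.

(* One iteration from [z]; [j] is only used when a boundary index is sampled. *)
Definition ms_iteration (j : 'I_M) z : ms_state :=
  let z' := centroid (ms_inner z) in
  if ms_inner z == set0 then Undefined
  else if z' != z then Running z'
  else if ms_boundary z' == set0 then Returned z'
  else Running ((#|ms_inner z|%:R + 1)^-1 *:
                (x j + \sum_(i in ms_inner z) x i)).

(* State after [t] iterations started at [x n], where [js t] is the index
   sampled during iteration [t] if that iteration samples. *)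
Fixpoint ms_run (n : 'I_M) (js : nat -> 'I_M) (t : nat) : ms_state :=
  if t is t'.+1 then
    if ms_run n js t' is Running z then ms_iteration (js t) z
    else ms_run n js t'
  else Running (x n).

(* Every index that the run actually samples lies in the prescribed set. The
   condition may depend on the past of the run, so adaptive and random choices
   are covered by ranging over all admissible [js]. *)
Definition admissible_samples (n : 'I_M) (js : nat -> 'I_M) : Prop :=
  forall t z, ms_run n js t = Running z ->
    ms_inner z != set0 ->
    centroid (ms_inner z) = z ->
    ms_boundary (centroid (ms_inner z)) != set0 ->
    js t.+1 \in ms_boundary (centroid (ms_inner z)).

End MeanShift.

Arguments Undefined {R d}.

(* Main.v *)
Require Import Defs.
From mathcomp Require Import all_boot all_order all_algebra.
From mathcomp Require Import reals topology normedtype.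
From mathcomp Require Import boolp ring.
Import Order.TTheory GRing.Theory Num.Theory.
Import numFieldNormedType.Exports.
Local Open Scope ring_scope.

(** For a set [A] of indices put
    [f_A y = \sum_(m in A) |x_m - y|^2 + (M - |A|) w^2].  Then [f <= f_A]
    everywhere, with equality at [z] when [A] lies between the inner set of [z]
    and its union with the boundary set, and
    [f_A y = f_A c + |A| |y - c|^2] with [c] the centroid of [A].  Hence every
    iteration that moves the point moves it to a centroid and strictly
    decreases [f].  There are finitely many centroids, so the run stops.  The
    average is never over an empty set because [f < M w^2] along the run.  At a
    returned point the boundary set is empty, so [f = f_A] in a neighbourhood,
    and the point minimizes [f_A]. *)

Lemma enorm_sqr (R : realType) (d : nat) (v : 'rV[R]_d) :
  enorm v ^+ 2 = \sum_(k < d) v 0 k ^+ 2.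
Proof. by rewrite sqr_sqrtr // sumr_ge0 // => k _; exact: sqr_ge0. Qed.

Lemma enorm_sqr_gt0 (R : realType) (d : nat) (v : 'rV[R]_d) :
  (0 < enorm v ^+ 2) = (v != 0).
Proof.
rewrite lt0r sqr_ge0 andbT enorm_sqr psumr_eq0; last by move=> k _; exact: sqr_ge0.
congr (~~ _); apply/allP/eqP => [v0|-> k _]; last by rewrite mxE expr0n eqxx.
apply/rowP => k; rewrite mxE.
by have := v0 k (mem_index_enum k); rewrite sqrf_eq0 => /eqP.
Qed.

Lemma enorm_sqrD (R : realType) (d : nat) (u v : 'rV[R]_d) :
  enorm (u + v) ^+ 2 =
  enorm u ^+ 2 + enorm v ^+ 2 + 2 * \sum_(k < d) u 0 k * v 0 k.
Proof.
rewrite !enorm_sqr mulr_sumr -!big_split /=.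
by apply: eq_bigr => k _; rewrite mxE; ring.
Qed.

Lemma enorm_sqr_continuous (R : realType) (d : nat) (a : 'rV[R]_d) :
  continuous (fun y : 'rV[R]_d => enorm (a - y) ^+ 2).
Proof.
under eq_fun do rewrite enorm_sqr.
apply: continuous_big; first exact: add_continuous.
move=> k _ y.
under eq_fun do rewrite !mxE expr2.
suff cv : continuous (fun t : 'rV[R]_d => a 0 k - t 0 k).
  exact: (cvgM (cv y) (cv y)).
by move=> t; apply: continuousB; [exact: cst_continuous | exact: coord_continuous].
Qed.

(** Division-free form of the average; it also covers the empty set, where both sides are zero. *)
Lemma scaler_centroid (R : realType) (d M : nat) (x : 'I_M -> 'rV[R]_d)
    (A : {set 'I_M}) :
  #|A|%:R *: centroid x A = \sum_(i in A) x i.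
Proof.
have [->|A0] := eqVneq A set0; first by rewrite cards0 scale0r big_set0.
by rewrite scalerA divff ?scale1r // pnatr_eq0 cards_eq0.
Qed.

(** The cross terms cancel because the deviations from the centroid sum to zero in each
    coordinate. *)
Lemma sum_enorm_sqr_centroid (R : realType) (d M : nat) (x : 'I_M -> 'rV[R]_d)
    (A : {set 'I_M}) (y : 'rV[R]_d) :
  \sum_(i in A) enorm (x i - y) ^+ 2 =
  \sum_(i in A) enorm (x i - centroid x A) ^+ 2 +
  #|A|%:R * enorm (centroid x A - y) ^+ 2.
Proof.
set c := centroid x A.
have cross : \sum_(i in A) 2 * \sum_(k < d) (x i - c) 0 k * (c - y) 0 k = 0.
  rewrite -mulr_sumr exchange_big big1 ?mulr0 //= => k _; rewrite -mulr_suml -summxE.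
  by rewrite sumrB -scaler_centroid sumr_const scaler_nat subrr mxE mul0r.
under eq_bigr => i _ do rewrite -(subrK c (x i)) -addrA enorm_sqrD.
by rewrite !big_split /= cross addr0 sumr_const mulr_natl.
Qed.

Section MeanShiftDescent.
Variables (R : realType) (d M : nat) (x : 'I_M -> 'rV[R]_d) (w : R).
Implicit Types (y z : 'rV[R]_d) (A : {set 'I_M}).

Local Notation f := (ms_objective x w).

(** This is [f_A], written as one sum over all indices so that it compares with [f] term by term. *)
Definition truncated_sum A y : R :=
  \sum_(m < M) if m \in A then enorm (x m - y) ^+ 2 else w ^+ 2.

Lemma truncated_sum_centroid A y :
  truncated_sum A y =
  truncated_sum A (centroid x A) + #|A|%:R * enorm (centroid x A - y) ^+ 2.
Proof.
have truncE v : truncated_sum A v =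
    \sum_(m in A) enorm (x m - v) ^+ 2 + \sum_(m in ~: A) w ^+ 2.
  rewrite /truncated_sum (bigID [in A]) /=; congr (_ + _).
    by apply: eq_bigr => m ->.
  by apply: eq_big => [m|m /negbTE ->//]; rewrite inE.
by rewrite !truncE sum_enorm_sqr_centroid addrAC.
Qed.

Lemma objective_le_truncated_sum A y : f y <= truncated_sum A y.
Proof.
by apply: ler_sum => m _; case: ifP => _; rewrite ge_min lexx ?orbT.
Qed.

(** At a boundary index both arguments of the minimum agree, so such an index may lie inside or
    outside [A]. *)
Lemma objective_eq_truncated_sum A z :
  ms_inner x w z \subset A -> A \subset ms_inner x w z :|: ms_boundary x w z ->
  f z = truncated_sum A z.
Proof.
move=> /subsetP IA /subsetP AIJ; apply: eq_bigr => m _; case: ifPn => [mA|mNA].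
  apply/min_idPl; have := AIJ m mA.
  by rewrite !inE => /orP[/ltW//|/eqP ->].
apply/min_idPr; rewrite leNgt; apply: contra mNA => mI.
by apply: IA; rewrite inE.
Qed.

(** With [c] the centroid, [f c <= f_A c < f_A z = f z]; the strict gap is [#|A|] times the squared
    distance from [c] to [z]. *)
Lemma objective_centroid_lt A z :
  ms_inner x w z \subset A -> A \subset ms_inner x w z :|: ms_boundary x w z ->
  A != set0 -> centroid x A != z -> f (centroid x A) < f z.
Proof.
move=> IA AIJ A0 Az.
rewrite (objective_eq_truncated_sum _ _ IA AIJ) truncated_sum_centroid.
apply: le_lt_trans (objective_le_truncated_sum A _) _.
by rewrite ltrDl mulr_gt0 ?enorm_sqr_gt0 ?subr_eq0 // ltr0n card_gt0.
Qed.

Lemma inner_neq0 z : f z < M%:R * w ^+ 2 -> ms_inner x w z != set0.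
Proof.
apply: contraTneq => I0; rewrite -leNgt -[M in M%:R]card_ord mulr_natl -sumr_const.
apply: ler_sum => m _; rewrite le_min lexx andbT leNgt.
by have := in_set0 m; rewrite -I0 inE => ->.
Qed.

(** The term of index [n] vanishes at [x n], and every other term is at most [w ^+ 2]. *)
Lemma objective_data_lt (n : 'I_M) : 0 < w -> f (x n) < M%:R * w ^+ 2.
Proof.
move=> w0; rewrite -[M in M%:R]card_ord mulr_natl -sumr_const.
rewrite /ms_objective (bigD1 n) //= [ltRHS](bigD1 n) //=.
apply: ltr_leD; last by apply: ler_sum => m _; rewrite ge_min lexx orbT.
rewrite subrr gt_min enorm_sqr big1 ?exprn_gt0 // => k _.
by rewrite mxE expr0n.
Qed.

Lemma local_minimum_of_fixpoint z :
  centroid x (ms_inner x w z) = z -> ms_boundary x w z = set0 ->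
  local_minimum f z.
Proof.
move=> cz J0; set I := ms_inner x w z.
(* Without boundary indices all the comparisons with [w ^+ 2] are strict at [z]. By continuity,
   finitely many strict comparisons persist nearby. *)
have sameI : \forall y \near z, forall m,
    if m \in I then enorm (x m - y) ^+ 2 < w ^+ 2
    else w ^+ 2 < enorm (x m - y) ^+ 2.
  apply: (@filter_forall _ _ _ (nbhs z)) => m.
  have cm := @enorm_sqr_continuous R d (x m) z.
  have := in_set0 m; rewrite -J0 !inE => mJ.
  case: ltgtP mJ => // lt_m _; [exact: cvgr_lt cm _ lt_m|exact: cvgr_gt cm _ lt_m].
apply: filterS sameI => y sameI.
have Iy : ms_inner x w y = I.
  apply/setP => m; have := sameI m; rewrite [LHS]inE.
  by case: ifP => _; [move=> -> | move=> /ltW; rewrite leNgt => /negbTE].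
rewrite (objective_eq_truncated_sum I y) ?Iy ?subsetUl //.
by rewrite truncated_sum_centroid cz (objective_eq_truncated_sum I z) ?subsetUl //
  lerDl mulr_ge0 ?ler0n ?sqr_ge0.
Qed.

Lemma iteration_boundary_centroid (j : 'I_M) z : j \in ms_boundary x w z ->
  (#|ms_inner x w z|%:R + 1)^-1 *: (x j + \sum_(i in ms_inner x w z) x i) =
  centroid x (j |: ms_inner x w z).
Proof.
rewrite inE => /eqP jJ; have jI : j \notin ms_inner x w z by rewrite inE jJ ltxx.
by rewrite /centroid cardsU1 jI big_setU1 //= natrD [1%:R + _]addrC.
Qed.

(** If adding [x j] left the centroid at [z], then [x j] would equal [z], although it lies at
    distance [w > 0] from it. *)
Lemma centroid_setU1_neq (j : 'I_M) z : 0 < w -> j \in ms_boundary x w z ->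
  centroid x (ms_inner x w z) = z -> centroid x (j |: ms_inner x w z) != z.
Proof.
move=> w0 jJ cz; apply/eqP => cz'.
have jI : j \notin ms_inner x w z.
  by move: jJ; rewrite !inE => /eqP ->; rewrite ltxx.
have := scaler_centroid _ _ _ x (j |: ms_inner x w z).
rewrite big_setU1 //= -scaler_centroid cz cz' cardsU1 jI natrD scalerDl scale1r.
move=> /addIr zj; move: jJ.
rewrite inE -zj subrr => /eqP jw.
have := exprn_gt0 2 w0; rewrite -jw enorm_sqr_gt0 eqxx //.
Qed.

Lemma ms_iteration_descent (j : 'I_M) z : 0 < w -> f z < M%:R * w ^+ 2 ->
  (ms_inner x w z != set0 -> centroid x (ms_inner x w z) = z ->
   ms_boundary x w (centroid x (ms_inner x w z)) != set0 ->
   j \in ms_boundary x w (centroid x (ms_inner x w z))) ->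
  (exists2 A, ms_iteration x w j z = Running (centroid x A) &
              f (centroid x A) < f z) \/
  (ms_iteration x w j z = Returned z /\ local_minimum f z).
Proof.
move=> w0 /inner_neq0 I0 /(_ I0) hj.
rewrite /ms_iteration (negbTE I0).
have [cz|cz] := eqVneq (centroid x (ms_inner x w z)) z; last first.
  by left; eexists; first reflexivity; exact: objective_centroid_lt (subsetUl _ _) _ _.
move: (hj cz); rewrite cz /=.
have [J0 _|J0 /(_ isT) jJ] := eqVneq (ms_boundary x w z) set0.
  by right; split=> //; exact: local_minimum_of_fixpoint.
left; exists (j |: ms_inner x w z); first by rewrite iteration_boundary_centroid.
apply: objective_centroid_lt; first exact: subsetUr.
- by rewrite setUC setUS // sub1set.
- by apply/set0Pn; exists j; rewrite setU11.
- exact: centroid_setU1_neq.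
Qed.

End MeanShiftDescent.

Theorem theorem1 (R : realType) (M d : nat) (hM : (1 <= M)%N) (hd : (1 <= d)%N)
    (x : 'I_M -> 'rV[R]_d) (w : R) (hw : 0 < w) (n : 'I_M)
    (js : nat -> 'I_M) (hjs : admissible_samples x w n js) :
  exists (T : nat) (z : 'rV[R]_d),
    ms_run x w n js T = Returned z /\ local_minimum (ms_objective x w) z.
Proof.
set f := ms_objective x w.
(* Induction on a strict bound [k] for the number of index sets whose centroid has a value below
   [f z]. *)
suff terminates k t z : ms_run x w n js t = Running z -> f z < M%:R * w ^+ 2 ->
    (#|[set A : {set 'I_M} | (f (centroid x A) < f z)%R]| < k)%N ->
    exists (T : nat) (z : 'rV[R]_d),
      ms_run x w n js T = Returned z /\ local_minimum f z.
  exact: (terminates _ 0%N (x n) erefl (objective_data_lt _ _ _ x w n hw) (ltnSn _)).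
elim: k t z => [//|k IHk] t z run_z fz lt_k.
have := ms_iteration_descent _ _ _ x w (js t.+1) z hw fz (hjs t z run_z).
have run_S : ms_run x w n js t.+1 = ms_iteration x w (js t.+1) z.
  by rewrite /= run_z.
rewrite -run_S => -[[A run_A fA]|[run_T z_min]]; last by exists t.+1, z.
apply: (IHk t.+1 _ run_A (lt_trans fA fz)).
(* The count drops: [A] was counted at [z], but its centroid is not strictly below itself. *)
apply: leq_trans (proper_card _) lt_k; apply/properP; split.
  by apply/subsetP => B; rewrite !inE => /lt_trans; exact.
by exists A; rewrite inE ?ltxx.
Qed.
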